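(* If $\mathcal{T}$ is an operator subsystem of $SOH(m)$ of dimension $n+1$, then $\mathcal{T}$ is unitally completely order isomorphic to $SOH(n)$.
   Context: For an integer $n\ge1$, $OH(n)$ is Pisier's self-dual operator space of dimension $n$: it has an orthonormal basis $e_1,\dots,e_n$ with $\|\sum_{i=1}^n A_i\otimes e_i\|=\|\sum_{i=1}^n A_i\otimes\overline{A_i}\|^{1/2}$ for all $p$ and all $A_i\in M_p$, where $\overline{A}$ is the entrywise complex conjugate and the norm on the right is that of $M_p\otimes M_p=M_{p^2}$. Fix a completely isometric inclusion $OH(n)\subseteq B(\mathcal{H})$. Let $H_0$ be the identity of $B(\mathcal{H}\oplus\mathcal{H})$ and $H_i=\begin{pmatrix}0&e_i\\ e_i^*&0\end{pmatrix}$, $1\le i\le n$. $SOH(n)\subseteq B(\mathcal{H}\oplus\mathcal{H})$ is the $(n+1)$-dimensional operator system spanned by $H_0,\dots,H_n$; for $n=0$ this is $SOH(0)=\mathbb{C}$. An operator subsystem is a unital self-adjoint subspace with the inherited matrix order. A complete order isomorphism is a linear bijection that is completely positive with completely positive inverse. *)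

(* Defs.v *)
From HB Require Import structures.
From mathcomp Require Import all_boot all_order all_algebra.
From mathcomp Require Import all_classical all_reals all_analysis.
From mathcomp Require Import complex mxtens.

Set Implicit Arguments.
Unset Strict Implicit.
Unset Printing Implicit Defensive.

Import Order.TTheory GRing.Theory Num.Theory.
Import numFieldNormedType.Exports.

Local Open Scope classical_set_scope.
Local Open Scope ring_scope.

(* Inner products are linear in the first variable. *)
HB.mixin Record hasDot (R : realType) H & GRing.Lmodule R[i] H := {
  dotp : {dot H for Num.conj}
}.

#[short(type="preHilbertType")]
HB.structure Definition PreHilbert (R : realType) :=
  {H of GRing.Lmodule R[i] H & hasDot R H}.

HB.mixin Record PreHilbert_isHilbert (R : realType) H
    & PreHilbert R H & CompleteNormedModule R[i] H := {
  normr_dotp : forall x : H, `|x| ^+ 2 = dotp x x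
}.

#[short(type="hilbertType")]
HB.structure Definition Hilbert (R : realType) :=
  {H of PreHilbert R H & CompleteNormedModule R[i] H
   & PreHilbert_isHilbert R H}.

Section ScalarHilbert.
Variable R : realType.

Definition scalar_dot (x y : R[i]^o) : R[i] := x * y^*.

Let scalar_dot_bilinear : bilinear_for *%R (Num.conj \; *%R) scalar_dot.
Proof.
split=> [y a x z|x a y z] /=; rewrite /scalar_dot.
  by rewrite mulrDl -mulrA.
by rewrite rmorphD rmorphM mulrDr mulrCA.
Qed.

HB.instance Definition _ := bilinear_isBilinear.Build R[i] R[i]^o R[i]^o R[i]
  *%R (Num.conj \; *%R) scalar_dot scalar_dot_bilinear.

Let scalar_dotC x y : scalar_dot x y = (-1) ^+ false * (scalar_dot y x)^*.
Proof.
rewrite /scalar_dot expr0 mul1r (rmorphM (Num.conj : R[i] -> R[i]) y) /=.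
by rewrite (conjCK (x : R[i])) mulrC.
Qed.

HB.instance Definition _ := isHermitianSesquilinear.Build R[i] R[i]^o false
  Num.conj scalar_dot scalar_dotC.

Let scalar_dot_gt0 x : x != 0 -> 0 < scalar_dot x x.
Proof. by rewrite /scalar_dot mul_conjC_gt0. Qed.

HB.instance Definition _ :=
  isDotProduct.Build R[i] R[i]^o scalar_dot scalar_dot_gt0.

HB.instance Definition _ := hasDot.Build R R[i]^o scalar_dot.

End ScalarHilbert.

(* The l^2 direct sum of p copies of H. *)
Definition hpow (T : Type) (p : nat) : Type := {ffun 'I_p -> T}.

Section PowerHilbert.
Variables (R : realType) (H : preHilbertType R) (p : nat).

HB.instance Definition _ := GRing.Lmodule.copy (hpow H p) {ffun 'I_p -> H}.

Definition hpow_dot (x y : hpow H p) : R[i] := \sum_k dotp (x k) (y k).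

Let hpow_dot_bilinear : bilinear_for *%R (Num.conj \; *%R) hpow_dot.
Proof.
split=> [y a x z|x a y z] /=; rewrite /hpow_dot mulr_sumr -big_split /=;
    apply: eq_bigr => k _; rewrite !ffunE.
  by rewrite linearDl/= linearZl_LR.
by rewrite linearDr/= linearZr_LR.
Qed.

HB.instance Definition _ := bilinear_isBilinear.Build R[i] (hpow H p)
  (hpow H p) R[i] *%R (Num.conj \; *%R) hpow_dot hpow_dot_bilinear.

Let hpow_dotC x y : hpow_dot x y = (-1) ^+ false * (hpow_dot y x)^*.
Proof.
rewrite expr0 mul1r /hpow_dot rmorph_sum; apply: eq_bigr => k _.
by rewrite hermC/= expr0 mul1r.
Qed.

HB.instance Definition _ := isHermitianSesquilinear.Build R[i] (hpow H p) false
  Num.conj hpow_dot hpow_dotC.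

Let hpow_dot_gt0 x : x != 0 -> 0 < hpow_dot x x.
Proof.
move=> x0; rewrite lt_def sumr_ge0 ?andbT => [|k _]; last exact: dnorm_ge0.
apply: contra x0; rewrite psumr_eq0 => [/allP h|k _]; last exact: dnorm_ge0.
apply/eqP/ffunP => k; rewrite ffunE; apply/eqP.
by have /implyP/(_ isT) := h k (mem_index_enum k); rewrite dnorm_eq0.
Qed.

HB.instance Definition _ :=
  isDotProduct.Build R[i] (hpow H p) hpow_dot hpow_dot_gt0.

HB.instance Definition _ := hasDot.Build R (hpow H p) hpow_dot.

End PowerHilbert.

Section Operators.
Variable R : realType.
Implicit Types H : preHilbertType R.

Definition hnorm H (x : H) : R := Num.sqrt (complex.Re (dotp x x)).

Definition opnorm H (T : H -> H) : R :=
  sup [set hnorm (T x) | x in [set x | hnorm x <= 1]].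

Definition posop H (T : H -> H) : Prop := forall x, 0 <= dotp (T x) x.

(* On a Hilbert space the adjoint of a bounded operator exists by the Riesz   *)
(* theorem; it is unique. The value 0 is taken when there is no adjoint.      *)
Definition adj H (T : H -> H) : H -> H :=
  xget 0 [set S | forall x y, dotp (T x) y = dotp x (S y)].

(* A p x p matrix of operators on H, acting on H^p. *)
Definition blockop H (p : nat) (X : 'M[H -> H]_p) : hpow H p -> hpow H p :=
  fun x => [ffun k => \sum_l X k l (x l)].

(* A \otimes T *)
Definition tensop H (p : nat) (A : 'M[R[i]]_p) (T : H -> H) :
    hpow H p -> hpow H p :=
  blockop (\matrix_(k, l) (A k l *: T)).

Definition mxop (q : nat) (M : 'M[R[i]]_q) :
    hpow R[i]^o q -> hpow R[i]^o q :=
  fun x => [ffun k => \sum_l M k l * x l].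

End Operators.

Section Subspaces.
Variables (F : fieldType) (V : lmodType F).

Definition linear_subspace (S : set V) : Prop :=
  S 0 /\ forall a x y, S x -> S y -> S (a *: x + y).

Definition lin_span n (b : 'I_n -> V) : set V :=
  [set \sum_i c i *: b i | c in [set: 'I_n -> F]].

Definition lin_indep n (b : 'I_n -> V) : Prop :=
  forall c : 'I_n -> F, \sum_i c i *: b i = 0 -> forall i, c i = 0.

Definition has_dim (S : set V) (n : nat) : Prop :=
  exists2 b : 'I_n -> V, lin_indep b & S = lin_span b.

End Subspaces.

Section OperatorSystems.
Variable R : realType.

(* S is an operator system on H, T an operator subsystem of S. *)
Definition operator_subsystem (H : preHilbertType R) (T S : set (H -> H)) :=
  [/\ T `<=` S, linear_subspace T, T idfun & forall x, T x -> T (adj x)].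

Definition completely_positive (H K : preHilbertType R) (S : set (H -> H))
    (phi : (H -> H) -> (K -> K)) : Prop :=
  forall p (X : 'M[H -> H]_p), (forall k l, S (X k l)) ->
    posop (blockop X) -> posop (blockop (map_mx phi X)).

(* Maps between operator systems S and T are given by functions on all of     *)
(* H -> H (resp. K -> K), of which only the restrictions to S and T matter.   *)
Definition unitally_coi (H K : preHilbertType R) (S : set (H -> H))
    (T : set (K -> K)) : Prop :=
  exists (phi : (H -> H) -> (K -> K)) (psi : (K -> K) -> (H -> H)),
    [/\ (forall a x y, S x -> S y -> phi (a *: x + y) = a *: phi x + phi y),
        (forall x, S x -> T (phi x) /\ psi (phi x) = x),
        (forall y, T y -> S (psi y) /\ phi (psi y) = y),
        completely_positive S phi /\ completely_positive T psi
      & phi idfun = idfun].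

(* e is the image, under a completely isometric inclusion OH(n) \subset B(H), *)
(* of the canonical basis of OH(n). H is required to be nonzero, which only   *)
(* matters for n = 0.                                                         *)
Definition OH_basis (H : hilbertType R) (n : nat) (e : 'I_n -> H -> H) : Prop :=
  [/\ exists x : H, x != 0,
      forall i, linear (e i) /\ continuous (e i)
    & forall p (A : 'I_n -> 'M[R[i]]_p),
        opnorm (\sum_i tensop (A i) (e i)) =
        Num.sqrt (opnorm (mxop (\sum_i A i *t map_mx Num.conj (A i))))].

(* The operator ((0, T), (T^*, 0)) on H (+) H. *)
Definition offdiag (H : hilbertType R) (T : H -> H) : hpow H 2 -> hpow H 2 :=
  blockop (\matrix_(k, l) if (k == 0) && (l == 1) then T
                          else if (k == 1) && (l == 0) then adj T else 0).

Definition SOH_gen (H : hilbertType R) (n : nat) (e : 'I_n -> H -> H)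
    (i : 'I_n.+1) : hpow H 2 -> hpow H 2 :=
  if unlift ord0 i is Some j then offdiag (e j) else idfun.

(* For n = 0 this is the line spanned by the identity, i.e. SOH(0) = C. *)
Definition SOH (H : hilbertType R) (n : nat) (e : 'I_n -> H -> H) :
    set (hpow H 2 -> hpow H 2) :=
  lin_span (SOH_gen e).

End OperatorSystems.

(* Main.v *)
From HB Require Import structures.
Require Import Defs.
From mathcomp Require Import all_boot all_order all_algebra.
From mathcomp Require Import all_classical all_reals all_analysis.
From mathcomp Require Import complex mxtens sesquilinear spectral.
From mathcomp Require Import ring lra.

(** Let H_i be the self-adjoint generators of SOH(m), built from an OH basis
    e_1, ..., e_m. The corollary combines two facts.

    Independence of the realization ([posop_soh_transfer], [SOH_coi]). Let X be
    the tensor sum of A_0 with the identity and of the A_i with H_i, an element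
    of M_p(SOH(n)). If X >= 0 then X is symmetric, so all A_i are Hermitian
    because the generators are linearly independent; also A_0 >= 0. For
    eps > 0 write A_0 + eps = C^* C with C invertible. The change of variables
    by C turns the diagonal of the 2 x 2 block operator X + eps into the
    identity and its corner into the sum of the B_i (x) e_i with
    B_i = C^{-*} A_i C^{-1}; completing the square, X + eps >= 0 says exactly
    that this corner has norm at most 1 ([pos_contraction]). The defining norm
    formula of OH(n) gives this norm in terms of the B_i alone, so it is the
    same for any two OH bases of the same size. Letting eps tend to 0, X >= 0
    for one basis if and only if X >= 0 for the other.

    Subsystems ([subsystem_SOH]). Taking adjoints in SOH(m) conjugates
    coordinates with respect to 1, H_1, ..., H_m. A subsystem T of dimension
    n + 1 therefore is the span of 1 and of an n-dimensional subspace of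
    C^m stable under conjugation, and such a subspace has an orthonormal basis
    Q of real vectors ([real_orthonormal_rows]). The OH norm formula is
    invariant under such an orthonormal change of basis, so the vectors
    sum_i Q_ji e_i form an OH basis ([OH_basis_rot]); as Q is real, their
    generators are the sum_i Q_ji H_i, and T is the operator system SOH of
    that basis.

    The corner of H_i is e_i^*, and [adj] only is the Hilbert adjoint when an
    adjoint exists; this is the Riesz representation theorem ([riesz],
    [adjP]), which is proved here by minimizing a quadratic functional. *)

Set Implicit Arguments.
Unset Strict Implicit.
Unset Printing Implicit Defensive.

Import Order.TTheory GRing.Theory Num.Theory.
Import numFieldNormedType.Exports.

Local Open Scope classical_set_scope.
Local Open Scope ring_scope.
Local Open Scope complex_scope.

Local Notation "M ^H" := (map_mx Num.conj M^T) (at level 8, format "M ^H").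

(** * Linear functions without a bundled structure *)

Section LinearFunctions.
Variables (F : pzRingType) (U V : lmodType F) (T : U -> V).
Hypothesis linT : linear T.

Let f : {linear U -> V} := HB.pack T (GRing.isLinear.Build _ _ _ _ T linT).

Lemma lin_fun0 : T 0 = 0. Proof. exact: (linear0 f). Qed.

Lemma lin_funD x y : T (x + y) = T x + T y. Proof. exact: (linearD f). Qed.

Lemma lin_funZ a x : T (a *: x) = a *: T x. Proof. exact: (linearZ_LR f). Qed.

Lemma lin_fun_sum I (r : seq I) (G : I -> U) :
  T (\sum_(i <- r) G i) = \sum_(i <- r) T (G i).
Proof. exact: (linear_sum f). Qed.

End LinearFunctions.

(** * Real parts of inner products and squared norms *)

Section SquaredNorm.
Variable R : realType.

Lemma conjCE (z : R[i]) : Num.conj z = complex.Re z -i* complex.Im z.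
Proof. by case: z. Qed.

Lemma ReD (z w : R[i]) : complex.Re (z + w) = complex.Re z + complex.Re w.
Proof. by case: z w => [a b] [c d]. Qed.

Lemma ReN (z : R[i]) : complex.Re (- z) = - complex.Re z.
Proof. by case: z. Qed.

Lemma Re_conj (z : R[i]) : complex.Re (Num.conj z) = complex.Re z.
Proof. by case: z. Qed.

Lemma Re_sum I (r : seq I) (P : pred I) (F : I -> R[i]) :
  complex.Re (\sum_(i <- r | P i) F i) = \sum_(i <- r | P i) complex.Re (F i).
Proof. exact: (big_morph _ ReD). Qed.

Lemma ReMr (a : R) (z : R[i]) : complex.Re (a%:C * z) = a * complex.Re z.
Proof. by case: z => x y /=; rewrite mul0r subr0. Qed.

Lemma ReMi (z : R[i]) : complex.Re ('i * z) = - complex.Im z.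
Proof. by case: z => x y /=; rewrite mul0r mul1r sub0r. Qed.

Lemma conj_rC (a : R) : Num.conj (a%:C : R[i]) = a%:C.
Proof. by rewrite conjCE /= oppr0. Qed.

Variable H : preHilbertType R.
Implicit Types x y z : H.

Definition redot x y : R := complex.Re (dotp x y).
Definition sqn x : R := redot x x.

Lemma dotpDl x y z : dotp (x + y) z = dotp x z + dotp y z.
Proof. exact: linearDl. Qed.
Lemma dotpDr x y z : dotp z (x + y) = dotp z x + dotp z y.
Proof. exact: linearDr. Qed.
Lemma dotpZl a x y : dotp (a *: x) y = a * dotp x y.
Proof. exact: linearZl_LR. Qed.
Lemma dotpZr a x y : dotp x (a *: y) = Num.conj a * dotp x y.
Proof. exact: linearZr_LR. Qed.
Lemma dotp0l y : dotp 0 y = 0.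
Proof. exact: linear0l. Qed.
Lemma dotp0r y : dotp y 0 = 0.
Proof. exact: linear0r. Qed.
Lemma dotpBl x y z : dotp (x - y) z = dotp x z - dotp y z.
Proof. exact: linearBl. Qed.
Lemma dotpBr x y z : dotp z (x - y) = dotp z x - dotp z y.
Proof. exact: linearBr. Qed.
Lemma dotp_suml I (r : seq I) (P : pred I) (F : I -> H) y :
  dotp (\sum_(i <- r | P i) F i) y = \sum_(i <- r | P i) dotp (F i) y.
Proof. exact: linear_sumlz. Qed.
Lemma dotp_sumr I (r : seq I) (P : pred I) (F : I -> H) y :
  dotp y (\sum_(i <- r | P i) F i) = \sum_(i <- r | P i) dotp y (F i).
Proof. exact: linear_sumr. Qed.
Lemma dotpC x y : dotp x y = Num.conj (dotp y x).
Proof. by rewrite [LHS]hermC expr0 mul1r. Qed.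

Lemma dotp_sqn x : dotp x x = (sqn x)%:C.
Proof.
by rewrite /sqn /redot [RHS]RRe_real// ger0_real// dnorm_ge0.
Qed.

Lemma sqn_ge0 x : 0 <= sqn x.
Proof. by have := dnorm_ge0 (@dotp R H) x; rewrite dotp_sqn ler0c. Qed.

Lemma sqn_eq0 x : (sqn x == 0) = (x == 0).
Proof.
have := dnorm_eq0 (@dotp R H) x; rewrite dotp_sqn => <-.
by apply/eqP/eqP => [->//|/complexI].
Qed.

Lemma redotC x y : redot x y = redot y x.
Proof. by rewrite /redot dotpC Re_conj. Qed.

Lemma redotDl x y z : redot (x + y) z = redot x z + redot y z.
Proof. by rewrite /redot dotpDl ReD. Qed.
Lemma redotDr x y z : redot z (x + y) = redot z x + redot z y.
Proof. by rewrite /redot dotpDr ReD. Qed.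
Lemma redotBl x y z : redot (x - y) z = redot x z - redot y z.
Proof. by rewrite /redot dotpBl ReD ReN. Qed.
Lemma redotBr x y z : redot z (x - y) = redot z x - redot z y.
Proof. by rewrite /redot dotpBr ReD ReN. Qed.
Lemma redotZl (a : R) x y : redot (a%:C *: x) y = a * redot x y.
Proof. by rewrite /redot dotpZl ReMr. Qed.
Lemma redotZr (a : R) x y : redot x (a%:C *: y) = a * redot x y.
Proof. by rewrite redotC redotZl redotC. Qed.

Lemma sqn0 : sqn 0 = 0. Proof. by rewrite /sqn /redot dotp0l. Qed.

Lemma sqnD x y : sqn (x + y) = sqn x + 2 * redot x y + sqn y.
Proof. rewrite /sqn redotDl !redotDr (redotC y x); ring. Qed.
Lemma sqnB x y : sqn (x - y) = sqn x - 2 * redot x y + sqn y.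
Proof. rewrite /sqn redotBl !redotBr (redotC y x); ring. Qed.
Lemma sqnZ (a : R) x : sqn (a%:C *: x) = a ^+ 2 * sqn x.
Proof. by rewrite /sqn redotZl redotZr mulrA expr2. Qed.
Lemma sqnZc (a : R[i]) x :
  sqn (a *: x) = (complex.Re a ^+ 2 + complex.Im a ^+ 2) * sqn x.
Proof.
rewrite {1}/sqn /redot dotpZl dotpZr dotp_sqn; case: a => a b /=; ring.
Qed.

Lemma dotp_ext x y : (forall z, dotp z x = dotp z y) -> x = y.
Proof.
move=> h; apply/eqP; rewrite -subr_eq0 -sqn_eq0 /sqn /redot.
by rewrite dotpBr h subrr.
Qed.

Lemma hnorm_sqr x : hnorm x ^+ 2 = sqn x.
Proof. by rewrite /hnorm sqr_sqrtr // sqn_ge0. Qed.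

Lemma discr_le (a b c : R) : 0 <= a ->
  (forall t, 0 <= a * t ^+ 2 + 2 * b * t + c) -> b ^+ 2 <= a * c.
Proof.
rewrite le_eqVlt => /predU1P[<-|a0] h; last first.
  have := h (- b / a); rewrite -(pmulr_rge0 _ a0).
  suff -> : a * (a * (- b / a) ^+ 2 + 2 * b * (- b / a) + c) = a * c - b ^+ 2.
    by rewrite subr_ge0.
  by field; rewrite gt_eqF.
rewrite mul0r; have [->|b0] := eqVneq b 0; first by rewrite expr0n.
have := h (- (c + 1) / (2 * b)).
suff -> : 0 * (- (c + 1) / (2 * b)) ^+ 2 + 2 * b * (- (c + 1) / (2 * b)) + c =
  -1.
  by rewrite oppr_ge0 ler10.
by field; rewrite b0.
Qed.

Lemma redot_sqr_le x y : redot x y ^+ 2 <= sqn x * sqn y.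
Proof.
apply: discr_le (sqn_ge0 x) _ => t.
have := sqn_ge0 (t%:C *: x + y); rewrite sqnD sqnZ redotZl => h.
by apply: le_trans h _; rewrite le_eqVlt; apply/orP; left; apply/eqP; ring.
Qed.

End SquaredNorm.

(** * Bounded operators have adjoints *)

(** Squared norms keep the constants in [R] and make sums of bounded maps
    bounded by the parallelogram law, without the triangle inequality. *)
Definition bdd (R : realType) (H K : preHilbertType R) (T : H -> K) : Prop :=
  exists2 c : R, 0 <= c & forall x, sqn (T x) <= c * sqn x.

Section Riesz.
Variables (R : realType) (H : hilbertType R).

Lemma normr_hnorm (x : H) : `|x| = (hnorm x)%:C.
Proof.
apply/eqP; rewrite -(eqrXn2 (n := 2))//; last first.
  by rewrite ler0c sqrtr_ge0.
by rewrite normr_dotp dotp_sqn -rmorphXn /= hnorm_sqr.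
Qed.

Lemma sqn_ball (x y : H) (r : R) : 0 < r ->
  ball x r%:C y <-> sqn (x - y) < r ^+ 2.
Proof.
move=> r0; rewrite -ball_normE /ball_ /= normr_hnorm ltcR -hnorm_sqr.
by rewrite ltr_pXn2r// ?nnegrE ?sqrtr_ge0// ltW.
Qed.

Lemma continuous_bdd (T : H -> H) : linear T -> continuous T -> bdd T.
Proof.
move=> linT cT.
pose f : {linear H -> H} := HB.pack T (GRing.isLinear.Build _ _ _ _ T linT).
have /linear_bounded_continuous/linear_boundedP : continuous f by [].
move=> /pinfty_ex_gt0[M M0 hM].
have Mr : M = (complex.Re M)%:C by rewrite [RHS]RRe_real// gtr0_real.
exists (complex.Re M ^+ 2); first exact: sqr_ge0.
move=> x; have := hM x; rewrite !normr_hnorm {1}Mr -rmorphM lecR => h.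
rewrite -!hnorm_sqr -exprMn lerXn2r// ?nnegrE ?sqrtr_ge0//.
by rewrite mulr_ge0 ?sqrtr_ge0// -ler0c -Mr ltW.
Qed.

(** The vector representing the functional [x |-> dotp (T x) y] minimizes the
    strictly convex functional [J x = sqn x - 2 * redot (T x) y]. By the
    parallelogram law the sets where [J] is close to its infimum are small, so
    they generate a Cauchy filter; its limit represents the functional, since a
    near-minimizer of [J] is a near-critical point in every direction. *)
Lemma riesz (T : H -> H) : linear T -> bdd T -> forall y, exists z,
  forall x, dotp (T x) y = dotp x z.
Proof.
move=> linT [c c0 hc] y.
have TD := lin_funD linT; have TZ := lin_funZ linT.
pose J x := sqn x - 2 * redot (T x) y.
pose S := [set J x | x in [set: H]].
have S0 : S !=set0 by exists (J 0), 0.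
(* [2 Re <T x, y> <= c^-1 |T x|^2 + c |y|^2 <= |x|^2 + c |y|^2] *)
have Slb : has_lbound S.
  exists (- (c * sqn y)) => _ [x _ <-].
  have [c00|c1] := eqVneq c 0.
    have /eqP Tx0 : T x == 0.
      by rewrite -sqn_eq0 eq_le sqn_ge0 andbT (le_trans (hc x))// c00 mul0r.
    by rewrite c00 mul0r oppr0 /J Tx0 /redot dotp0l mulr0 subr0 sqn_ge0.
  have := sqn_ge0 ((c^-1)%:C *: T x - y).
  rewrite sqnB sqnZ redotZl => h1; have {}c0 : 0 < c by rewrite lt_def c1.
  have /(ler_wpM2l (ltW c0)) := h1; rewrite mulr0 => h2.
  have h3 : c^-1 * sqn (T x) <= sqn x by rewrite ler_pdivrMl.
  rewrite /J.
  apply: le_trans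
    (_ : - (c * sqn y) <= c^-1 * sqn (T x) - 2 * redot (T x) y) _.
    rewrite -subr_ge0; apply: le_trans h2 _.
    rewrite le_eqVlt; apply/orP; left; apply/eqP; field; exact: c1.
  by rewrite lerD2r.
pose j := inf S.
have jle x : j <= J x by apply: ge_inf => //; exists x.
have jex e : 0 < e -> exists x, J x < j + e.
  move=> e0; have [|_ [x _ <-] hx] := @inf_adherent R S e e0; first by split.
  by exists x.
have Jpar x x' : sqn (x - x') <= 2 * (J x - j) + 2 * (J x' - j).
  have := jle ((2^-1)%:C *: (x + x')).
  rewrite /J sqnZ TZ TD redotZl redotDl sqnD sqnB => h.
  move: h; lra.
(* [J (x + t *: h) >= j] for all [t], hence a discriminant bound *)
have quad x e h : J x < j + e ->
    (redot h x - redot (T h) y) ^+ 2 <= sqn h * e.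
  move=> hx; apply: discr_le (sqn_ge0 h) _ => t.
  have := jle (x + t%:C *: h);
    rewrite {1}/J TD TZ sqnD sqnZ redotZr redotDl redotZl.
  rewrite (redotC x h).
  move: hx; rewrite /J; set a := sqn h; set b := sqn x; set p := redot h x.
  set q := redot _ y; set r := redot _ y.
  by move=> h1 h2; nra.
pose F := filter_from [set e : R | 0 < e] (fun e => [set x | J x < j + e]).
have FF : ProperFilter F.
  apply: filter_from_proper => [|e e0]; last by have [x] := jex e e0; exists x.
  apply: filter_from_filter; first by exists 1 => /=.
  move=> a b /= a0 b0; exists (Num.min a b); first by rewrite /= lt_min a0.
  move=> x /= hx; split; apply: lt_le_trans hx _; rewrite lerD2l.
    by rewrite ge_min lexx.
  by rewrite ge_min lexx orbT.
have cF : cvg F.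
  apply/cauchy_cvgP/cauchyP => eps eps0.
  have epsE : eps = (complex.Re eps)%:C by rewrite [RHS]RRe_real// gtr0_real.
  have r0 : 0 < complex.Re eps by rewrite -ltcR -epsE.
  set r := complex.Re eps in epsE r0.
  have d0 : 0 < r ^+ 2 / 8 by rewrite divr_gt0// exprn_gt0.
  have [x hx] := jex _ d0; exists x; exists (r ^+ 2 / 8) => //= x' /= hx'.
  rewrite epsE; apply/sqn_ball => //; apply: le_lt_trans (Jpar x x') _.
  have := exprn_gt0 2 r0; move: hx hx'; lra.
pose z := lim F.
have key h : redot (T h) y = redot h z.
  apply/eqP; rewrite -subr_eq0 -sqrf_eq0 eq_le sqr_ge0 andbT.
  apply/ler_addgt0Pl => e e0; rewrite addr0.
  have h1 : 0 < 2 * sqn h + 2 * sqn h + 1 :> R by have := sqn_ge0 h; lra.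
  pose d := Num.min 1 (e / (2 * sqn h + 2 * sqn h + 1)).
  have d0 : 0 < d by rewrite lt_min ltr01 divr_gt0.
  have dle : d * (2 * sqn h + 2 * sqn h + 1) <= e.
    by rewrite -ler_pdivlMr// ge_min lexx orbT.
  have d1 : d <= 1 by rewrite ge_min lexx.
  have /(_ (ball z d%:C)) : F --> z by exact: cF.
  have nz : nbhs z (ball z d%:C) by apply: nbhsx_ballx; rewrite ltcR.
  move=> /(_ nz) [e' /= e'0 he'].
  have m0 : 0 < Num.min e' d by rewrite lt_min e'0.
  have [x hx] := jex _ m0.
  have /he'/sqn_ball : J x < j + e'.
    by apply: lt_le_trans hx _; rewrite lerD2l ge_min lexx.
  move=> /(_ d0) hxz.
  have hx' : J x < j + d.
    by apply: lt_le_trans hx _; rewrite lerD2l ge_min lexx orbT.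
  (* both errors are at most [sqn h * d] after squaring: [x] is critical up to
     [d], and [x] is close to [z] *)
  have q1 := quad _ _ h hx'.
  have := redot_sqr_le h (z - x); rewrite redotBr => q2.
  have q3 : sqn h * sqn (z - x) <= sqn h * d.
    apply: ler_wpM2l; first exact: sqn_ge0.
    apply: le_trans (ltW hxz) _.
    by rewrite expr2 ler_piMl// ltW.
  have {}q2 := le_trans q2 q3.
  set u := redot h x - _ in q1; set v := redot h z - redot h x in q2.
  have -> : redot (T h) y - redot h z = - (u + v) by rewrite /u /v; ring.
  have uv : (- (u + v)) ^+ 2 <= 2 * u ^+ 2 + 2 * v ^+ 2.
    have := sqr_ge0 (u - v); nra.
  apply: le_trans uv _; nra.
exists z => x; apply/eqP; rewrite eq_complex.
have := key x; rewrite /redot => ->; rewrite eqxx /=.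
have := key ('i *: x); rewrite TZ /redot !dotpZl !ReMi => /oppr_inj->.
exact: eqxx.
Qed.

Lemma adjP (T : H -> H) : linear T -> bdd T ->
  forall x y, dotp (T x) y = dotp x (adj T y).
Proof.
move=> linT bT; have /choice[S hS] := riesz linT bT.
rewrite /adj; case: xgetP => [_ _ //|/(_ S)] []; exact: (fun x y => hS y x).
Qed.

End Riesz.

Lemma adj_unique (R : realType) (H : preHilbertType R) (T S : H -> H) :
  (forall x y, dotp (T x) y = dotp x (S y)) -> adj T = S.
Proof.
move=> hS; rewrite /adj; case: xgetP => [S' _ hS'|/(_ S)[]//].
by apply/funext => y; apply: dotp_ext => z; rewrite -hS' hS.
Qed.

(** * Operator norms *)

Section Bounded.
Variable R : realType.
Implicit Types H K L : preHilbertType R.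

Lemma bdd0 H K : bdd (0 : H -> K).
Proof. by exists 0 => // x; rewrite sqn0 mul0r. Qed.

Lemma bddD H K (S T : H -> K) : bdd S -> bdd T -> bdd (S + T).
Proof.
move=> [a a0 ha] [b b0 hb]; exists (2 * a + 2 * b); first by lra.
move=> x; have := sqn_ge0 (S x - T x); rewrite sqnB => h.
have -> : (S + T) x = S x + T x by [].
by rewrite sqnD; have := ha x; have := hb x; lra.
Qed.

Lemma bddZ H K (a : R[i]) (T : H -> K) : bdd T -> bdd (a *: T).
Proof.
move=> [c c0 hc].
have d0 := addr_ge0 (sqr_ge0 (complex.Re a)) (sqr_ge0 (complex.Im a)).
exists ((complex.Re a ^+ 2 + complex.Im a ^+ 2) * c); first exact: mulr_ge0.
by move=> x; rewrite [sqn _]sqnZc -mulrA ler_wpM2l.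
Qed.

Lemma bdd_sum H K I (r : seq I) (T : I -> H -> K) :
  (forall i, bdd (T i)) -> bdd (\sum_(i <- r) T i).
Proof. by move=> bT; elim/big_ind : _ => //; [exact: bdd0|exact: bddD]. Qed.

Lemma bdd_comp H K L (S : K -> L) (T : H -> K) : bdd S -> bdd T -> bdd (S \o T).
Proof.
move=> [a a0 ha] [b b0 hb]; exists (a * b); first exact: mulr_ge0.
by move=> x /=; apply: le_trans (ha _) _; rewrite -mulrA ler_wpM2l.
Qed.

Lemma sqn_hpow H p (x : hpow H p) : sqn x = \sum_k sqn (x k).
Proof. exact: Re_sum. Qed.

Lemma bdd_coord H p (l : 'I_p) : bdd (fun x : hpow H p => x l).
Proof.
exists 1 => // x; rewrite mul1r sqn_hpow (bigD1 l)//= lerDl.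
by apply: sumr_ge0 => k _; exact: sqn_ge0.
Qed.

Lemma bdd_blockop H p (X : 'M[H -> H]_p) :
  (forall k l, bdd (X k l)) -> bdd (blockop X).
Proof.
move=> bX.
have /choice[c hc] : forall k, exists c : R, 0 <= c /\
    forall x, sqn (blockop X x k) <= c * sqn x.
  move=> k; have [c c0 hc] : bdd (\sum_l (X k l \o (fun x : hpow H p => x l))).
    by apply: bdd_sum => l; have := bdd_comp (bX k l) (@bdd_coord H p l).
  by exists c; split => // x; rewrite ffunE; have := hc x; rewrite fct_sumE.
exists (\sum_k c k); first by apply: sumr_ge0 => k _; case: (hc k).
by move=> x; rewrite sqn_hpow mulr_suml ler_sum// => k _; case: (hc k).
Qed.

Lemma opnorm_ge0 H (T : H -> H) : 0 <= opnorm T.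
Proof.
rewrite /opnorm; set S := [set _ | _ in _].
have S0 : S (hnorm (T 0)) by exists 0; rewrite //= /hnorm dotp0l sqrtr0.
have [hS|/sup_out->//] := pselect (has_sup S).
by apply: le_trans (ub_le_sup hS.2 S0); exact: sqrtr_ge0.
Qed.

Lemma sqn_le_opnorm H (T : H -> H) : linear T -> bdd T ->
  forall x, sqn (T x) <= opnorm T ^+ 2 * sqn x.
Proof.
move=> linT [c c0 hc] x.
have TZ := lin_funZ linT.
have [/eqP|x0] := eqVneq (sqn x) 0.
  rewrite sqn_eq0 => /eqP ->; rewrite lin_fun0//.
  by rewrite sqn0 mulr0.
have {}x0 : 0 < hnorm x by rewrite lt_def sqrtr_ge0 -sqrf_eq0 hnorm_sqr x0.
pose y := ((hnorm x)^-1)%:C *: x.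
have ny z : hnorm (((hnorm x)^-1)%:C *: z) = (hnorm x)^-1 * hnorm z.
  apply/eqP; rewrite -(eqrXn2 (n := 2))// ?mulr_ge0 ?invr_ge0 ?sqrtr_ge0//.
  by rewrite hnorm_sqr sqnZ exprMn hnorm_sqr.
have : hnorm (T y) <= opnorm T.
  apply: ub_le_sup; last by exists y => //=; rewrite ny mulVf ?gt_eqF.
  exists (Num.sqrt c) => _ [z /= hz <-]; apply: ler_wsqrtr.
  have := hc z; move/le_trans; apply.
  by rewrite -[leRHS]mulr1 ler_wpM2l// -hnorm_sqr expr_le1// sqrtr_ge0.
rewrite TZ ny mulrC ler_pdivrMr// => h.
by rewrite -!hnorm_sqr -exprMn lerXn2r// ?nnegrE ?sqrtr_ge0// mulr_ge0
  ?opnorm_ge0 ?sqrtr_ge0.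
Qed.

Lemma opnorm_le1 H (T : H -> H) :
  (forall x, sqn (T x) <= sqn x) -> opnorm T <= 1.
Proof.
move=> hT; apply: ge_sup; first by exists (hnorm (T 0)), 0 => //=;
  rewrite /hnorm dotp0l sqrtr0.
move=> _ [x /= hx <-]; apply: le_trans hx.
exact: ler_wsqrtr (hT x).
Qed.

End Bounded.

(** * Amplifications *)

Section Amplification.
Variables (R : realType) (H : preHilbertType R) (p : nat).
Implicit Types (x y : hpow H p) (M N : 'M[R[i]]_p).

Lemma hpowDE x y k : (x + y) k = x k + y k. Proof. exact: ffunE. Qed.
Lemma hpowZE (a : R[i]) x k : (a *: x) k = a *: x k. Proof. exact: ffunE. Qed.
Lemma hpow0E k : (0 : hpow H p) k = 0. Proof. exact: ffunE. Qed.
Lemma hpow_sumE I (r : seq I) (F : I -> hpow H p) k :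
  (\sum_(i <- r) F i) k = \sum_(i <- r) F i k.
Proof. by apply: (big_morph (fun x : hpow H p => x k) (fun x y =>
  hpowDE x y k) (hpow0E k)). Qed.

Lemma dotp_hpow x y : dotp x y = \sum_k dotp (x k) (y k).
Proof. by []. Qed.

(** [M] tensored with the identity of [H]. *)
Definition mxact M : hpow H p -> hpow H p := tensop M idfun.

Definition ampl n (A : 'I_n -> 'M[R[i]]_p) (e : 'I_n -> H -> H) :
    hpow H p -> hpow H p :=
  \sum_i tensop (A i) (e i).

Definition delta_h (l : 'I_p) (h : H) : hpow H p :=
  [ffun k => if k == l then h else 0].

Lemma tensopE M (T : H -> H) x k : tensop M T x k = \sum_l M k l *: T (x l).
Proof. by rewrite ffunE; apply: eq_bigr => l _; rewrite mxE. Qed.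

Lemma mxactE M x k : mxact M x k = \sum_l M k l *: x l.
Proof. exact: tensopE. Qed.

Lemma amplE n (A : 'I_n -> 'M[R[i]]_p) e x k :
  ampl A e x k = \sum_i \sum_l A i k l *: e i (x l).
Proof.
by rewrite /ampl fct_sumE hpow_sumE; apply: eq_bigr => i _; rewrite tensopE.
Qed.

Lemma mxact_linear M : linear (mxact M).
Proof.
move=> a x y; apply/ffunP => k;
  rewrite hpowDE hpowZE !mxactE scaler_sumr -big_split.
apply: eq_bigr => l _ /=.
by rewrite hpowDE hpowZE scalerDr !scalerA [M k l * a]mulrC.
Qed.

Lemma ampl_linear n (A : 'I_n -> 'M[R[i]]_p) e :
  (forall i, linear (e i)) -> linear (ampl A e).
Proof.
move=> lin a x y; apply/ffunP => k;
  rewrite hpowDE hpowZE !amplE scaler_sumr -big_split.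
apply: eq_bigr => i _ /=; rewrite scaler_sumr -big_split;
  apply: eq_bigr => l _ /=.
by rewrite hpowDE hpowZE lin scalerDr !scalerA [A i k l * a]mulrC.
Qed.

Lemma mxactM M N x : mxact (M *m N) x = mxact M (mxact N x).
Proof.
apply/ffunP => k; rewrite !mxactE;
  under [RHS]eq_bigr do rewrite mxactE scaler_sumr.
rewrite exchange_big; apply: eq_bigr => l _ /=.
by rewrite mxE scaler_suml; apply: eq_bigr => j _; rewrite scalerA.
Qed.

Lemma mxact_scalar a x : mxact a%:M x = a *: x.
Proof.
apply/ffunP => k; rewrite mxactE hpowZE (bigD1 k)//= big1 => [|l lk].
  by rewrite addr0 mxE eqxx mulr1n.
by rewrite mxE eq_sym (negPf lk) mulr0n scale0r.
Qed.

Lemma mxactD M N x : mxact (M + N) x = mxact M x + mxact N x.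
Proof.
apply/ffunP => k; rewrite hpowDE !mxactE -big_split.
by apply: eq_bigr => l _; rewrite mxE scalerDl.
Qed.

Lemma dotp_mxact M x y : dotp (mxact M x) y = dotp x (mxact M^H y).
Proof.
rewrite !dotp_hpow; under eq_bigr do rewrite mxactE dotp_suml.
under [RHS]eq_bigr do rewrite mxactE dotp_sumr.
rewrite exchange_big; apply: eq_bigr => l _; apply: eq_bigr => k _.
by rewrite dotpZl dotpZr !mxE conjCK.
Qed.

Lemma dotp_ampl n (A : 'I_n -> 'M[R[i]]_p) e e' x y :
  (forall i u v, dotp (e i u) v = dotp u (e' i v)) ->
  dotp (ampl A e x) y = dotp x (ampl (fun i => (A i)^H) e' y).
Proof.
move=> he; rewrite !dotp_hpow; under eq_bigr do rewrite amplE dotp_suml.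
under [RHS]eq_bigr do rewrite amplE dotp_sumr.
rewrite exchange_big [RHS]exchange_big; apply: eq_bigr => i _.
under eq_bigr do rewrite dotp_suml.
under [RHS]eq_bigr do rewrite dotp_sumr.
rewrite exchange_big; apply: eq_bigr => l _; apply: eq_bigr => k _.
by rewrite dotpZl dotpZr !mxE conjCK he.
Qed.

Lemma ampl_mul n (A : 'I_n -> 'M[R[i]]_p) e M N x : (forall i, linear (e i)) ->
  ampl (fun i => M *m A i *m N) e x = mxact M (ampl A e (mxact N x)).
Proof.
move=> lin.
apply/ffunP => k; rewrite mxactE;
  under [RHS]eq_bigr do rewrite amplE scaler_sumr.
rewrite amplE [RHS]exchange_big; apply: eq_bigr => i _.
under [RHS]eq_bigr => j _.
  under eq_bigr => l _ do rewrite mxactE lin_fun_sum// scaler_sumr.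
  rewrite exchange_big scaler_sumr; over.
rewrite exchange_big; apply: eq_bigr => l _.
rewrite mxE scaler_suml.
under [LHS]eq_bigr do rewrite mxE mulr_suml scaler_suml.
rewrite exchange_big; apply: eq_bigr => j _.
rewrite scaler_sumr; apply: eq_bigr => j' _.
by rewrite (lin_funZ (lin i)) !scalerA.
Qed.

Lemma bdd_ampl n (A : 'I_n -> 'M[R[i]]_p) e :
  (forall i, bdd (e i)) -> bdd (ampl A e).
Proof.
move=> be; apply: bdd_sum => i; apply: bdd_blockop => k l.
by rewrite mxE; exact: bddZ.
Qed.

Lemma mxact_delta M l h k : mxact M (delta_h l h) k = M k l *: h.
Proof.
rewrite mxactE (bigD1 l)//= ffunE eqxx big1 ?addr0// => j jl.
by rewrite ffunE (negPf jl) scaler0.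
Qed.

Lemma mxact_inj M N (h : H) : h != 0 -> mxact M = mxact N -> M = N.
Proof.
move=> h0 MN; apply/matrixP => k l; apply/eqP.
have := congr1 (fun T : hpow H p -> hpow H p => T (delta_h l h) k) MN;
  rewrite !mxact_delta => /eqP.
by rewrite -subr_eq0 -scalerBl scaler_eq0 (negPf h0) orbF subr_eq0.
Qed.

End Amplification.

(** Polarization: the form is real at [x + y] and at ['i *: x + y], which gives
    the imaginary and the real part of the equality. *)
Lemma posop_sym (R : realType) (H : preHilbertType R) (T : H -> H) :
  linear T -> posop T -> forall x y, dotp (T x) y = dotp x (T y).
Proof.
move=> linT pT x y.
have TD := lin_funD linT; have TZ := lin_funZ linT.
have h u v : complex.Im (dotp (T u) v) = - complex.Im (dotp (T v) u).
  have := ger0_Im (pT (u + v)); rewrite TD dotpDl !dotpDr.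
  have := ger0_Im (pT u); have := ger0_Im (pT v).
  move: (dotp _ u) (dotp _ v) (dotp (T u) v) (dotp (T v) u) =>
    [? ?] [? ?] [? ?] [? ?] /=.
  by move=> -> ->; rewrite add0r addr0 => /eqP; rewrite addr_eq0 => /eqP.
have h1 := h x y; have h2 := h ('i *: x) y.
rewrite [RHS]dotpC conjCE; move: h2 h1; rewrite TZ dotpZl dotpZr conjCE.
case: (dotp (T x) y) (dotp (T y) x) => [a b] [c d] /= h2 h1.
by congr Complex; move: h1 h2; lra.
Qed.

(** In a spectral decomposition [P^* D P] of [A] the diagonal [D] is
    nonnegative, and [C = (D + eps)^(1/2) P] has [C^* C = A + eps]. Positivity
    is assumed for the amplification of [A] to some [H != 0], the form in which
    it comes out of an element of M_p(SOH(n)). *)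
Lemma pos_factor (R : realType) (H : preHilbertType R) (h : H) p
    (A : 'M[R[i]]_p) (eps : R) : h != 0 -> 0 < eps ->
  posop (@mxact R H p A) ->
  exists2 C : 'M[R[i]]_p, C \in unitmx & A + eps%:C%:M = C^H *m C.
Proof.
move=> h0 eps0 pA.
have symA := posop_sym (mxact_linear A) pA.
have AA : A^H = A.
  apply: (mxact_inj h0); apply/funext => x; apply: dotp_ext => z.
  by rewrite -dotp_mxact symA.
have nA : A \is normalmx by apply/normalmxP; rewrite AA.
have /orthomx_spectralP := nA; set P := spectralmx A; set D := spectral_diag A.
have uP : P \is unitarymx by exact: spectral_unitarymx.
have unP := unitarymx_unit uP.
rewrite invmx_unitary// => AE.
have PP : P *m P^H = 1%:M by exact/unitarymxP.
have PP' : P^H *m P = 1%:M by rewrite -invmx_unitary// mulVmx.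
have D0 j : 0 <= D 0 j.
  have := pA (mxact P^H (delta_h j h)).
  rewrite -dotp_mxact -!mxactM {1}AE.
  rewrite !mulmxA PP mul1mx -mulmxA PP mulmx1 dotp_hpow (bigD1 j)//=.
  rewrite big1 => [|k kj];
    last by rewrite [delta_h j h k]ffunE (negPf kj) dotp0r.
  rewrite addr0 mxact_delta [delta_h j h j]ffunE eqxx dotpZl mxE eqxx mulr1n.
  by rewrite dotp_sqn pmulr_lge0// ltcR lt_def sqn_eq0 h0 sqn_ge0.
pose d j : R[i] := (Num.sqrt (complex.Re (D 0 j) + eps))%:C.
have dE j : d j * d j = D 0 j + eps%:C.
  have DE : D 0 j = (complex.Re (D 0 j))%:C.
    by rewrite [RHS]RRe_real// ger0_real.
  have r0 : 0 <= complex.Re (D 0 j) + eps.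
    by have := D0 j; rewrite DE ler0c; lra.
  by rewrite [in RHS]DE -(rmorphM (real_complex R)) -expr2 sqr_sqrtr// rmorphD.
have d0 j : d j != 0.
  apply/eqP => dj0; have := dE j; rewrite dj0 mul0r => /esym/eqP.
  by rewrite gt_eqF// ltr_wpDl// ltcR.
pose E := diag_mx (\row_j d j).
have EH : E^H = E.
  rewrite tr_diag_mx map_diag_mx; congr diag_mx.
  by apply/rowP => j; rewrite !mxE; exact: conj_rC.
exists (E *m P).
  rewrite unitmx_mul unP andbT unitmxE det_diag unitfE; apply/prodf_neq0 => j _.
  by rewrite mxE.
rewrite trmx_mul map_mxM EH -mulmxA (mulmxA E).
have -> : E *m E = diag_mx D + eps%:C%:M.
  apply/matrixP => k l; rewrite mul_diag_mx !mxE.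
  have [->|kl] := eqVneq k l; first by rewrite !mulr1n dE.
  by rewrite !mulr0n mulr0 addr0.
rewrite mulmxDl mulmxDr mulmxA -AE; congr (_ + _).
by rewrite mulmxA scalar_mxC -mulmxA PP' mulmx1.
Qed.

(** * The operator systems SOH(n) *)

Lemma opnorm0 (R : realType) (H : preHilbertType R) : opnorm (0 : H -> H) = 0.
Proof.
apply/eqP; rewrite eq_le opnorm_ge0 andbT; apply: ge_sup.
  by exists (hnorm (0 : H)), 0; rewrite //= /hnorm dotp0l sqrtr0.
by move=> _ [x _ <-]; rewrite /hnorm dotp0l sqrtr0.
Qed.

Lemma offdiagE (R : realType) (H : hilbertType R) (T : H -> H) z k :
  offdiag T z k = if k == 0 then T (z 1) else adj T (z 0).
Proof.
rewrite ffunE big_ord_recl big_ord1 !mxE.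
have -> : lift ord0 ord0 = 1 :> 'I_2 by exact: val_inj.
by case: k => -[|[|]]//= ?; rewrite ?add0r ?addr0.
Qed.

Section OneBasis.
Variables (R : realType) (H : hilbertType R) (n : nat) (e : 'I_n -> H -> H).
Hypothesis he : OH_basis e.

Let lin_e i : linear (e i). Proof. by case: he => _ h _; case: (h i). Qed.
Let adj_e i u v : dotp (e i u) v = dotp u (adj (e i) v).
Proof.
by case: he => _ h _; case: (h i) => *; exact/adjP/continuous_bdd.
Qed.

Lemma adj_linear i : linear (adj (e i)).
Proof.
move=> a x y; apply: dotp_ext => z.
by rewrite -adj_e !dotpDr !dotpZr -!adj_e.
Qed.

(** For 1 x 1 matrices the norm formula says that [\sum_i c i *: e i] has norm
    [sqrt (\sum_i `|c i| ^+ 2)]. *)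
Lemma OH_lin_indep : lin_indep e.
Proof.
move=> c ce0; pose A i : 'M[R[i]]_1 := (c i)%:M.
pose M := \sum_i A i *t map_mx Num.conj (A i).
have Ae0 : ampl A e = 0.
  apply/funext => x; apply/ffunP => k; rewrite amplE [RHS]ffunE.
  transitivity ((\sum_i c i *: e i) (x k)); last by rewrite ce0.
  rewrite fct_sumE; apply: eq_bigr => i _.
  by rewrite big_ord1 (ord1 k) mxE eqxx mulr1n.
have [_ _ /(_ _ A)] := he.
rewrite -/(ampl A e) Ae0 opnorm0 => /esym/eqP; rewrite sqrtr_eq0 => M0.
have {}M0 : opnorm (mxop M) = 0 by apply/eqP; rewrite eq_le M0 opnorm_ge0.
have mxopE : mxop M = mxact M.
  by apply/funext => x; apply/ffunP => k; rewrite mxactE ffunE.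
have {M0 mxopE}MM : mxact M =
  mxact (0 : 'M[R[i]]_(1 * 1)) :> (hpow R[i]^o _ -> _).
  apply/funext => x; apply/eqP; rewrite -subr_eq0.
  have -> : mxact 0 x = 0 :> hpow R[i]^o _.
    by apply/ffunP => k; rewrite mxactE big1 ?hpow0E// => l _;
      rewrite mxE scale0r.
  rewrite subr0 -sqn_eq0 eq_le sqn_ge0 andbT.
  have := @sqn_le_opnorm R (hpow R[i]^o _) _ (mxact_linear M) _ x.
  rewrite -mxopE M0 expr0n mul0r; apply.
  rewrite mxopE; apply: bdd_blockop => k l; rewrite mxE.
  by apply: bddZ; exists 1 => // y; rewrite mul1r.
have M00 : M = 0 by apply: (@mxact_inj R R[i]^o _ _ _ 1 _ MM); exact: oner_neq0.
pose k0 := mxtens_index (0 : 'I_1, 0 : 'I_1).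
have /(congr1 (fun N : 'M[R[i]]_(1 * 1) => N k0 k0)) := M00.
rewrite summxE mxE => /eqP.
under eq_bigr => i _ do rewrite tensmxE !mxE eqxx mulr1n.
rewrite psumr_eq0 => [/allP h i|i _]; last exact: mul_conjC_ge0.
by have /implyP/(_ isT) := h i (mem_index_enum i);
  rewrite mul_conjC_eq0 => /eqP.
Qed.

(** The general element [\sum_i A i \otimes H_i] of M_p(SOH(n)). *)
Definition soh_mx p (A : 'I_n.+1 -> 'M[R[i]]_p) : 'M[hpow H 2 -> hpow H 2]_p :=
  \matrix_(k, l) \sum_i A i k l *: SOH_gen e i.

(** The identification of [H^p (+) H^p] with [(H (+) H)^p]. *)
Definition pack p (u v : hpow H p) : hpow (hpow H 2) p :=
  [ffun k => [ffun j : 'I_2 => if j == 0 then u k else v k]].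

Lemma packE p (u v : hpow H p) k j :
  pack u v k j = if j == 0 then u k else v k.
Proof. by rewrite !ffunE. Qed.

Lemma packP p (x : hpow (hpow H 2) p) : exists u v, x = pack u v.
Proof.
exists [ffun k => x k 0], [ffun k => x k 1]; apply/ffunP => k; apply/ffunP => j.
rewrite !ffunE; case: ifP => [/eqP->//|]; case: j => -[|[|]]//= j1 _.
by congr (x k _); exact: val_inj.
Qed.

Lemma dotp_pack p (u v u' v' : hpow H p) :
  dotp (pack u v) (pack u' v') = dotp u u' + dotp v v'.
Proof.
rewrite !dotp_hpow -big_split; apply: eq_bigr => k _.
by rewrite dotp_hpow !ffunE big_ord_recl big_ord1 !ffunE.
Qed.

(** In this identification [soh_mx A] is the 2 x 2 block operator with
    [A ord0] twice on the diagonal. *)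
Lemma soh_mxE p (A : 'I_n.+1 -> 'M[R[i]]_p) u v :
  blockop (soh_mx A) (pack u v) =
  pack (mxact (A ord0) u + ampl (fun i => A (lift ord0 i)) e v)
       (mxact (A ord0) v
        + ampl (fun i => A (lift ord0 i)) (fun i => adj (e i)) u).
Proof.
apply/ffunP => k; apply/ffunP => j.
rewrite ffunE hpow_sumE packE.
under eq_bigr => l _ do rewrite mxE fct_sumE hpow_sumE.
rewrite exchange_big big_ord_recl.
have lE i : SOH_gen e (lift ord0 i) = offdiag (e i) by rewrite /SOH_gen liftK.
have l0E : SOH_gen e ord0 = idfun by rewrite /SOH_gen unlift_none.
case: ifP => j0.
  rewrite (eqP j0) hpowDE mxactE amplE; congr (_ + _).
    by apply: eq_bigr => l _; rewrite l0E hpowZE packE.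
  apply: eq_bigr => i _; apply: eq_bigr => l _.
  by rewrite hpowZE lE offdiagE packE.
have -> : j = 1 by apply/val_inj; move: j0; case: (j) => -[|[|]].
rewrite hpowDE mxactE amplE; congr (_ + _).
  by apply: eq_bigr => l _; rewrite l0E hpowZE packE.
apply: eq_bigr => i _; apply: eq_bigr => l _.
by rewrite hpowZE lE offdiagE /= packE.
Qed.

(** The identity is diagonal and the other generators are off-diagonal. *)
Lemma SOH_gen_lin_indep : lin_indep (SOH_gen e).
Proof.
move=> c c0.
pose A i : 'M[R[i]]_1 := (c i)%:M.
have AE u v : blockop (soh_mx A) (pack u v) = 0.
  apply/ffunP => k; rewrite ffunE [RHS]ffunE big_ord1 mxE.
  transitivity ((\sum_i c i *: SOH_gen e i) (pack u v 0)); last by rewrite c0.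
  by rewrite !fct_sumE; apply: eq_bigr => i _; rewrite (ord1 k) mxE eqxx mulr1n.
have [[h h0] _ _] := he.
have cE u v : c ord0 *: u + (\sum_(i < n) c (lift ord0 i) *: e i) v = 0.
  have := AE [ffun=> u] [ffun=> v].
  move=> /(congr1 (fun x : hpow (hpow H 2) 1 => x 0 0)).
  rewrite soh_mxE packE eqxx !hpow0E hpowDE mxactE amplE big_ord1 ffunE mxE
    eqxx mulr1n => <-.
  congr (_ + _); rewrite fct_sumE; apply: eq_bigr => i _.
  by rewrite big_ord1 ffunE mxE eqxx mulr1n.
have ev0 : \sum_(i < n) c (lift ord0 i) *: e i = 0.
  by apply/funext => v; have := cE 0 v; rewrite scaler0 add0r.
have c00 : c ord0 = 0.
  by have /eqP := cE h 0; rewrite ev0 addr0 scaler_eq0 (negPf h0) orbF => /eqP.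
by move=> i; case: (unliftP ord0 i) => [j|] ->//;
  exact: (@OH_lin_indep (fun i => c (lift ord0 i)) ev0 j).
Qed.

Lemma soh_linear p (A : 'I_n.+1 -> 'M[R[i]]_p) : linear (blockop (soh_mx A)).
Proof.
move=> a x y; have [u [v ->]] := packP x; have [u' [v' ->]] := packP y.
have pl a' w1 w2 w3 w4 : a' *: pack w1 w2 + pack w3 w4 =
    pack (a' *: w1 + w3) (a' *: w2 + w4) :> hpow (hpow H 2) p.
  apply/ffunP => k; apply/ffunP => j;
    rewrite hpowDE hpowZE hpowDE hpowZE !packE.
  by case: ifP => _; rewrite hpowDE hpowZE.
rewrite pl !soh_mxE pl; congr pack; rewrite mxact_linear ampl_linear//.
- by rewrite scalerDr addrACA.
- by rewrite scalerDr addrACA.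
- exact: adj_linear.
Qed.

Lemma dotp_soh p (A : 'I_n.+1 -> 'M[R[i]]_p) u v u' v' :
  dotp (blockop (soh_mx A) (pack u v)) (pack u' v') =
  dotp (mxact (A ord0) u) u' + dotp (mxact (A ord0) v) v'
  + (dotp (ampl (fun i => A (lift ord0 i)) e v) u'
     + dotp u (ampl (fun i => (A (lift ord0 i))^H) e v')).
Proof.
rewrite soh_mxE dotp_pack !dotpDl -addrA addrACA addrA; congr (_ + (_ + _)).
by apply: dotp_ampl => i x y; rewrite dotpC -adj_e -dotpC.
Qed.

(** A positive operator is symmetric; comparing corners, the [A i] and their
    adjoints have the same amplification, and [e] is linearly independent. *)
Lemma soh_coefs_sym p (A : 'I_n.+1 -> 'M[R[i]]_p) :
  posop (blockop (soh_mx A)) -> forall i, (A i)^H = A i.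
Proof.
move=> pA; have sA := posop_sym (soh_linear A) pA.
have [[h h0] _ _] := he.
have am0 (B : 'I_n -> 'M[R[i]]_p) := lin_fun0 (ampl_linear B lin_e).
have mx0 (M : 'M[R[i]]_p) := lin_fun0 (@mxact_linear R H p M).
have A0 : (A ord0)^H = A ord0.
  apply: (mxact_inj h0); apply/funext => x; apply: dotp_ext => z.
  have := sA (pack z 0) (pack x 0).
  rewrite [RHS]dotpC !dotp_soh !mx0 !am0 !(dotp0l, dotp0r) !addr0 -dotpC.
  by rewrite dotp_mxact.
have A1 v : ampl (fun i => (A (lift ord0 i))^H) e v =
    ampl (fun i => A (lift ord0 i)) e v.
  apply: dotp_ext => u; have := sA (pack u 0) (pack 0 v).
  rewrite [RHS]dotpC !dotp_soh !mx0 !am0 !(dotp0l, dotp0r) !addr0 !add0r => ->.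
  by rewrite -dotpC.
move=> i; case: (unliftP ord0 i) => [j|] ->//.
apply/matrixP => k l; apply/eqP; rewrite -subr_eq0; apply/eqP.
apply: (@OH_lin_indep (fun j =>
  (A (lift ord0 j))^H k l - A (lift ord0 j) k l) _ j).
apply/funext => w; rewrite fct_sumE.
have := congr1 (fun x : hpow H p => x k) (A1 (delta_h l w));
  rewrite !amplE => /eqP.
rewrite -subr_eq0 -sumrB => /eqP A1k; rewrite -[RHS]/(0 : H) -[RHS]A1k.
apply: eq_bigr => i' _.
rewrite -sumrB (bigD1 l)//= [delta_h l w l]ffunE eqxx -scalerBl big1 ?addr0//
  => l' ll'.
rewrite [delta_h l w l']ffunE (negPf ll').
by rewrite (lin_fun0 (lin_e i')) !scaler0 subr0.
Qed.

End OneBasis.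

(** After the change of variables [x = C v, y = C u], with [S] the transformed
    corner, [|y|^2 + |x|^2 + 2 Re <S x, y> >= 0]: taking [y = - S x] gives
    [|S x| <= |x|], and conversely the form is at least [|S x + y|^2]. *)
Lemma pos_contraction (R : realType) (H : preHilbertType R) n p
    (e : 'I_n -> H -> H) (C : 'M[R[i]]_p) (A : 'I_n -> 'M[R[i]]_p) :
  (forall i, linear (e i)) -> C \in unitmx ->
  (forall u v : hpow H p,
     0 <= sqn (mxact C u) + sqn (mxact C v) + 2 * redot (ampl A e v) u) <->
  (forall x : hpow H p,
     sqn (ampl (fun i => (invmx C)^H *m A i *m invmx C) e x) <= sqn x).
Proof.
move=> lin_e uC; set B := fun i => _.
have CK x : mxact C (mxact (invmx C) x) = x :> hpow H p.
  by rewrite -mxactM mulmxV// mxact_scalar scale1r.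
have CiK x : mxact (invmx C) (mxact C x) = x :> hpow H p.
  by rewrite -mxactM mulVmx// mxact_scalar scale1r.
have SE x y : redot (ampl B e x) y =
    redot (ampl A e (mxact (invmx C) x)) (mxact (invmx C) y) :> R.
  by rewrite /redot /B ampl_mul// dotpC -dotp_mxact -dotpC.
split=> h.
- move=> x; set y := ampl B e x.
  have := h (mxact (invmx C) (- y)) (mxact (invmx C) x).
  rewrite !CK -SE -/y /sqn /redot hnormN linearNr ReN -!/(redot _ _) -/(sqn _);
    lra.
- move=> u v; have := h (mxact C v).
  have := sqn_ge0 (ampl B e (mxact C v) + mxact C u).
  rewrite sqnD SE !CiK; lra.
Qed.

Section Transfer.
Variables (R : realType) (H K : hilbertType R) (n : nat).
Variables (e : 'I_n -> H -> H) (f : 'I_n -> K -> K).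
Hypotheses (he : OH_basis e) (hf : OH_basis f).

(** For Hermitian coefficients the two corners contribute conjugate numbers. *)
Lemma dotp_soh_self (L : hilbertType R) (g : 'I_n -> L -> L) p
    (A : 'I_n.+1 -> 'M[R[i]]_p) u v :
  OH_basis g -> (forall i, (A i)^H = A i) ->
  dotp (blockop (soh_mx g A) (pack u v)) (pack u v) =
  (redot (mxact (A ord0) u) u + redot (mxact (A ord0) v) v
   + 2 * redot (ampl (fun i => A (lift ord0 i)) g v) u)%:C.
Proof.
move=> hg hA; rewrite dotp_soh//.
have -> : (fun i => (A (lift ord0 i))^H) = (fun i => A (lift ord0 i)).
  by apply/funext => i; rewrite hA.
have rA w : dotp (mxact (A ord0) w) w = (redot (mxact (A ord0) w) w)%:C.
  have : dotp (mxact (A ord0) w) w = Num.conj (dotp (mxact (A ord0) w) w).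
    by rewrite -dotpC dotp_mxact hA.
  rewrite /redot; case: (dotp _ _) => a b [] h /=.
  by congr Complex; lra.
rewrite !rA [X in _ + (_ + X)]dotpC.
rewrite /redot; case: (dotp (ampl _ _ _) _) => a b.
by apply/eqP; rewrite eq_complex; apply/andP; split; apply/eqP => /=; ring.
Qed.

(** Positivity is a condition on [A] alone: writing [A ord0 + d = C^* C], it
    bounds the norm of [\sum_i B i \otimes e i] with [B i = C^{-*} A i C^{-1}],
    which the OH formula expresses by [B]. *)
Lemma posop_soh_transfer p (A : 'I_n.+1 -> 'M[R[i]]_p) :
  posop (blockop (soh_mx e A)) -> posop (blockop (soh_mx f A)).
Proof.
move=> pA; have hA := soh_coefs_sym he pA.
have [[h h0] cle ne] := he; have [[k k0] clf nf] := hf.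
have lin_e i : linear (e i) by case: (cle i).
have lin_f i : linear (f i) by case: (clf i).
have bdd_f i : bdd (f i) by apply: continuous_bdd => //; case: (clf i).
set A' := fun i => A (lift ord0 i).
have ppos u v : 0 <= redot (mxact (A ord0) u) u + redot (mxact (A ord0) v) v
    + 2 * redot (ampl A' e v) u.
  by have := pA (pack u v); rewrite dotp_soh_self// ler0c.
have pA0 : posop (@mxact R H p (A ord0)).
  move=> u; have := pA (pack u 0); rewrite dotp_soh//.
  have a0 (D : 'I_n -> 'M[R[i]]_p) := lin_fun0 (ampl_linear D lin_e).
  by rewrite !a0 (lin_fun0 (mxact_linear _)) !(dotp0l, dotp0r) !addr0.
move=> x; have [u [v ->]] := packP x; rewrite dotp_soh_self// ler0c -/A'.
apply/ler_addgt0Pr => eps eps0.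
(* perturbing [A ord0] by [d] changes the form at [(u, v)] by at most [eps] *)
pose d := eps / (sqn u + sqn v + 1).
have s0 : 0 < sqn u + sqn v + 1 by have := sqn_ge0 u; have := sqn_ge0 v; lra.
have d0 : 0 < d by rewrite divr_gt0.
have [C uC AC] := pos_factor h0 d0 pA0.
have CE (L : preHilbertType R) (w : hpow L p) :
    sqn (mxact C w) = redot (mxact (A ord0) w) w + d * sqn w.
  have : sqn (mxact C w) = redot (mxact (C^H *m C) w) w.
    by rewrite /redot mxactM dotpC -dotp_mxact -dotpC.
  by rewrite -AC mxactD mxact_scalar redotDl redotZl => ->.
have := (pos_contraction A' lin_e uC).1; set B := fun i => _.
have /[swap]/[apply] ce : forall u v : hpow H p,
    0 <= sqn (mxact C u) + sqn (mxact C v) + 2 * redot (ampl A' e v) u.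
  move=> u' v'; rewrite !CE; have := ppos u' v'.
  have := sqn_ge0 u'; have := sqn_ge0 v'; nra.
have cf : forall x : hpow K p, sqn (ampl B f x) <= sqn x.
  have o1 : opnorm (ampl B f) <= 1 by rewrite [leLHS]nf -ne; exact: opnorm_le1.
  move=> w; apply: le_trans (sqn_le_opnorm _ _ w) _.
  - exact: ampl_linear.
  - exact: bdd_ampl.
  - by rewrite ler_piMl ?sqn_ge0// expr_le1// opnorm_ge0.
have := (pos_contraction A' lin_f uC).2 cf u v; rewrite !CE.
have dE : d * sqn u + d * sqn v <= eps.
  have : d * (sqn u + sqn v + 1) = eps by rewrite /d divfK// gt_eqF.
  lra.
lra.
Qed.

End Transfer.

(** * Real orthonormal bases of conjugation-invariant subspaces *)

(** Gram-Schmidt: split off a unit vector of the row space and continue in its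
    orthogonal complement, the intersection with a kernel. *)
Lemma orthonormal_rows (R : realType) m n :
  forall k (U : 'M[R]_(k, m)), \rank U = n ->
  exists2 Q : 'M[R]_(n, m), Q *m Q^T = 1%:M & (Q <= U)%MS.
Proof.
elim: n => [k U _|n IH]; last rewrite -[n.+1]/(1 + n)%N => k U rU.
  by exists 0; [apply/matrixP => -[]|exact: sub0mx].
have /rowV0Pn[w wU w0] : U != 0 by rewrite -mxrank_eq0 rU.
pose s := (w *m w^T) 0 0.
have sE : s = \sum_i w 0 i ^+ 2.
  by rewrite /s mxE; apply: eq_bigr => i _; rewrite mxE expr2.
have s0 : 0 < s.
  rewrite lt_def sE sumr_ge0 ?andbT => [|i _]; last exact: sqr_ge0.
  apply: contra w0; rewrite psumr_eq0 => [/allP h|i _]; last exact: sqr_ge0.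
  apply/eqP/rowP => i; rewrite mxE; apply/eqP; rewrite -sqrf_eq0.
  by have := h i (mem_index_enum i).
pose w1 := (Num.sqrt s)^-1 *: w.
have w1U : (w1 <= U)%MS by exact: scalemx_sub.
have ww1 : w1 *m w1^T = 1%:M.
  rewrite linearZ /= -scalemxAl -scalemxAr [w *m _]mx11_scalar -/s
    !scale_scalar_mx.
  by rewrite mulrA -invfM -expr2 sqr_sqrtr ?(ltW s0)// mulVf// gt_eqF.
have rU' : \rank (U :&: kermx w1^T)%MS = n.
  have := mxrank_mul_ker U w1^T; rewrite rU.
  have -> : \rank (U *m w1^T) = 1%N; last by case.
  apply/eqP; rewrite eqn_leq rank_leq_col /= lt0n mxrank_eq0; apply/eqP => Uw.
  have /submxP[D w1E] := w1U.
  have := ww1; rewrite {1}w1E -mulmxA Uw mulmx0 => /matrixP/(_ 0 0)/eqP.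
  by rewrite !mxE eqxx eq_sym oner_eq0.
have [Q QQ QU] := IH _ _ rU'.
move: QU; rewrite sub_capmx => /andP[QU /sub_kermxP Qw].
exists (col_mx w1 Q : 'M[R]_(1 + n, m)); last by rewrite col_mx_sub w1U.
rewrite tr_col_mx mul_col_row ww1 Qw QQ (_ : w1 *m Q^T = 0); last first.
  by rewrite -[LHS]trmxK trmx_mul trmxK Qw trmx0.
by rewrite -scalar_mx_block.
Qed.

(** The row space contains the real and imaginary parts of its vectors, so it is
    spanned by real vectors. *)
Lemma real_orthonormal_rows (R : realType) k m n (B : 'M[R[i]]_(k, m)) :
  (map_mx Num.conj B <= B)%MS -> \rank B = n ->
  exists2 Q : 'M[R]_(n, m), Q *m Q^T = 1%:M &
    (map_mx (real_complex R) Q <= B)%MS.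
Proof.
move=> cB rB.
pose W := col_mx (map_mx (@complex.Re R) B) (map_mx (@complex.Im R) B).
have WB : (map_mx (real_complex R) W <= B)%MS.
  rewrite map_col_mx col_mx_sub; apply/andP; split.
    have -> : map_mx (real_complex R) (map_mx (@complex.Re R) B)
        = 2^-1 *: (B + map_mx Num.conj B).
      apply/matrixP => i j; rewrite !mxE mulrC; exact: ReJ_add.
    by apply: scalemx_sub; exact: addmx_sub.
  have -> : map_mx (real_complex R) (map_mx (@complex.Im R) B)
      = (2^-1 * 'i) *: (map_mx Num.conj B - B).
    apply/matrixP => i j; rewrite !mxE [RHS]mulrC mulrA; exact: ImJ_sub.
  by apply: scalemx_sub; apply: addmx_sub => //; rewrite eqmx_opp.
have BW : (B <= map_mx (real_complex R) W)%MS.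
  have -> : B = row_mx 1%:M 'i%:M *m map_mx (real_complex R) W.
    rewrite map_col_mx mul_row_col mul1mx mul_scalar_mx.
    by apply/matrixP => i j; rewrite !mxE; exact: complexE.
  exact: submxMl.
have rW : \rank W = n.
  by rewrite -(mxrank_map (real_complex R)) -rB; apply/eqP;
    rewrite eqn_leq !mxrankS.
have [Q QQ QW] := orthonormal_rows rW; exists Q => //.
by apply: submx_trans WB; rewrite map_submx.
Qed.

(** * Rotating an OH basis *)

Section Rotation.
Variables (R : realType) (H : hilbertType R) (m n : nat).
Variables (e : 'I_m -> H -> H) (Q : 'M[R]_(n, m)).
Hypotheses (he : OH_basis e) (QQ : Q *m Q^T = 1%:M).

Definition rot_basis (j : 'I_n) : H -> H := \sum_i (Q j i)%:C *: e i.

Lemma tensop_rot p (A : 'I_n -> 'M[R[i]]_p) :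
  \sum_j tensop (A j) (rot_basis j) =
  \sum_i tensop (\sum_j (Q j i)%:C *: A j) (e i).
Proof.
apply/funext => x; apply/ffunP => k.
rewrite -/(ampl A rot_basis) -/(ampl _ e) !amplE.
under [RHS]eq_bigr => i _.
  under eq_bigr => l _ do rewrite summxE scaler_suml.
  rewrite exchange_big; over.
rewrite [RHS]exchange_big; apply: eq_bigr => j _ /=.
rewrite [RHS]exchange_big; apply: eq_bigr => l _ /=.
rewrite /rot_basis fct_sumE scaler_sumr; apply: eq_bigr => i _.
by rewrite mxE -!scalerA [RHS]scalerA mulrC -scalerA.
Qed.

(** The tensor [\sum_i B i \otimes conj (B i)] is invariant under an orthonormal
    real change of the [B i]. *)
Lemma OH_basis_rot : OH_basis rot_basis.
Proof.
have [h0 lc ne] := he; split=> // [j|p A].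
  split.
    move=> a x y; rewrite /rot_basis !fct_sumE scaler_sumr -big_split.
    apply: eq_bigr => i _ /=; have [lin_e _] := lc i.
    by rewrite -[LHS]/(_ *: e i _) -[(_ *: e i) x]/(_ *: e i x)
      -[(_ *: e i) y]/(_ *: e i y) lin_e scalerDr !scalerA [_%:C * a]mulrC.
  rewrite /rot_basis; elim/big_ind : _ => [|f g cf cg|i _] x.
  - exact: cst_continuous.
  - exact: continuousD (cf x) (cg x).
  - by apply: continuousZr; case: (lc i) => _; exact.
rewrite tensop_rot ne; congr (Num.sqrt (opnorm (mxop _))).
apply/matrixP => r s.
rewrite -(mxtens_unindexK r) -(mxtens_unindexK s).
case: (mxtens_unindex r) (mxtens_unindex s) => [k k'] [l l'].
rewrite !summxE.
under eq_bigr => i _.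
  rewrite tensmxE mxE !summxE rmorph_sum mulr_suml.
  under eq_bigr => j _ do rewrite mulr_sumr.
  over.
under [RHS]eq_bigr => j _ do rewrite tensmxE [X in _ * X]mxE.
rewrite exchange_big; apply: eq_bigr => j _ /=.
rewrite exchange_big /= (bigD1 j)//= [X in _ + X]big1 => [|j' jj'].
  rewrite addr0.
  have -> : A j k l * (A j k' l')^* =
      ((Q *m Q^T) j j)%:C * (A j k l * (A j k' l')^*).
    by rewrite QQ mxE eqxx mul1r.
  rewrite mxE rmorph_sum mulr_suml; apply: eq_bigr => i _.
  by rewrite !mxE (rmorphM Num.conj) (rmorphM (real_complex R)) /= conj_rC;
    ring.
transitivity (((Q *m Q^T) j j')%:C * (A j k l * (A j' k' l')^*)).
  rewrite mxE rmorph_sum mulr_suml; apply: eq_bigr => i _.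
  by rewrite !mxE (rmorphM Num.conj) (rmorphM (real_complex R)) /= conj_rC;
    ring.
by rewrite QQ mxE eq_sym (negPf jj') mul0r.
Qed.

Lemma adj_rot j x : adj (rot_basis j) x = \sum_i (Q j i)%:C *: adj (e i) x.
Proof.
have [_ lc _] := he.
rewrite (@adj_unique _ _ _ (fun x => \sum_i (Q j i)%:C *: adj (e i) x))//.
move=> {}x y; rewrite /rot_basis fct_sumE dotp_suml dotp_sumr.
apply: eq_bigr => i _; have [lin_e c_e] := lc i.
rewrite -[(_ *: e i) x]/(_ *: e i x) dotpZl dotpZr conj_rC adjP//.
exact: continuous_bdd.
Qed.

End Rotation.

(** * Coordinates *)

Section Coordinates.
Variables (F : fieldType) (V : lmodType F) (N : nat) (g : 'I_N -> V).

Definition lin_comb (r : 'rV[F]_N) : V := \sum_k r 0 k *: g k.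

Definition coef (x : V) : 'I_N -> F :=
  xget 0 [set c | x = \sum_k c k *: g k].

Lemma coefP x : lin_span g x -> \sum_k coef x k *: g k = x.
Proof.
by case=> c _ cx; rewrite /coef; case: xgetP => [c' _ ->//|/(_ c)[]].
Qed.

Lemma lin_comb_mulmx k (D : 'rV[F]_k) (B : 'M[F]_(k, N)) :
  lin_comb (D *m B) = \sum_j D 0 j *: lin_comb (row j B).
Proof.
under [RHS]eq_bigr do rewrite scaler_sumr.
rewrite [RHS]exchange_big; apply: eq_bigr => i _ /=.
rewrite mxE scaler_suml; apply: eq_bigr => j _.
by rewrite scalerA mxE.
Qed.

Hypothesis indep_g : lin_indep g.

Lemma span_eq (c d : 'I_N -> F) :
  \sum_k c k *: g k = \sum_k d k *: g k -> forall i, c i = d i.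
Proof.
move=> /eqP; rewrite -subr_eq0 -sumrB => /eqP cd i; apply/eqP.
rewrite -subr_eq0; apply/eqP; apply: (indep_g (c := fun i => c i - d i)) i.
by rewrite -[RHS]cd; apply: eq_bigr => i _; rewrite scalerBl.
Qed.

Lemma lin_comb_inj : injective lin_comb.
Proof. by move=> r s rs; apply/rowP; exact: span_eq. Qed.

Lemma coef_sum c i : coef (\sum_k c k *: g k) i = c i.
Proof. by move: i; apply: span_eq; apply: coefP; exists c. Qed.

End Coordinates.

(** * Complete order isomorphism of realizations of SOH(n) *)

Section Isomorphism.
Variables (R : realType) (n : nat).

Definition soh_map (H K : hilbertType R) (e : 'I_n -> H -> H)
    (f : 'I_n -> K -> K) (x : hpow H 2 -> hpow H 2) : hpow K 2 -> hpow K 2 :=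
  \sum_i coef (SOH_gen e) x i *: SOH_gen f i.

Lemma soh_mapK (H K : hilbertType R) (e : 'I_n -> H -> H)
    (f : 'I_n -> K -> K) x :
  OH_basis f -> SOH e x -> soh_map f e (soh_map e f x) = x.
Proof.
move=> hf ex; rewrite -[RHS](coefP ex); apply: eq_bigr => i _.
by congr (_ *: _); exact: (coef_sum (SOH_gen_lin_indep hf)).
Qed.

Lemma soh_map_cp (H K : hilbertType R) (e : 'I_n -> H -> H)
    (f : 'I_n -> K -> K) :
  OH_basis e -> OH_basis f -> completely_positive (SOH e) (soh_map e f).
Proof.
move=> he hf p X eX pX.
pose A i : 'M[R[i]]_p := \matrix_(k, l) coef (SOH_gen e) (X k l) i.
have XE : X = soh_mx e A.
  apply/matrixP => k l; rewrite mxE -[LHS](coefP (eX k l)).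
  by apply: eq_bigr => i _; rewrite mxE.
have -> : map_mx (soh_map e f) X = soh_mx f A.
  by apply/matrixP => k l; rewrite !mxE; apply: eq_bigr => i _; rewrite mxE.
by apply: (posop_soh_transfer he hf); rewrite -XE.
Qed.

Lemma SOH_coi (H K : hilbertType R) (e : 'I_n -> H -> H) (f : 'I_n -> K -> K) :
  OH_basis e -> OH_basis f -> unitally_coi (SOH e) (SOH f).
Proof.
move=> he hf; exists (soh_map e f), (soh_map f e).
have ie := SOH_gen_lin_indep he.
have in_soh (L M : hilbertType R) (g : 'I_n -> L -> L) (h : 'I_n -> M -> M) x :
  SOH h (soh_map g h x) by exists (coef (SOH_gen g) x).
split.
- move=> a x y ex ey; rewrite /soh_map scaler_sumr -big_split;
  apply: eq_bigr => i _ /=.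
  rewrite scalerA -scalerDl -[in LHS](coefP ex) -[in LHS](coefP ey) scaler_sumr
    -big_split.
  under eq_bigr => k _ do rewrite /= scalerA -scalerDl.
  by rewrite coef_sum.
- by move=> x ex; split; [exact: in_soh|exact: soh_mapK].
- by move=> y fy; split; [exact: in_soh|exact: soh_mapK].
- by split; exact: soh_map_cp.
have gen0 (L : hilbertType R) (g : 'I_n -> L -> L) : idfun = SOH_gen g ord0.
  by rewrite /SOH_gen unlift_none.
rewrite (gen0 H e) (gen0 K f) /soh_map.
have -> : SOH_gen e ord0 = \sum_k (k == ord0)%:R *: SOH_gen e k.
  rewrite (bigD1 ord0)//= scale1r big1 ?addr0// => k /negPf ->.
  by rewrite scale0r.
under eq_bigr => i _ do rewrite coef_sum//.
rewrite (bigD1 ord0)//= scale1r big1 ?addr0// => k /negPf ->.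
by rewrite scale0r.
Qed.

End Isomorphism.

(** * Operator subsystems of SOH(m) *)

Section Subsystem.
Variables (R : realType) (H : hilbertType R) (m : nat) (e : 'I_m -> H -> H).
Hypothesis he : OH_basis e.

Lemma SOH_gen_selfadjoint i x y :
  dotp (SOH_gen e i x) y = dotp x (SOH_gen e i y).
Proof.
have [_ lc _] := he.
rewrite /SOH_gen; case: (unlift ord0 i) => [j|//].
have [lin_e c_e] := lc j; have adj_e := adjP lin_e (continuous_bdd lin_e c_e).
rewrite !dotp_hpow !big_ord_recl !big_ord0 !addr0 !offdiagE /=.
have -> : lift ord0 ord0 = 1 :> 'I_2 by exact: val_inj.
by rewrite adj_e [RHS]addrC; congr (_ + _); rewrite dotpC -adj_e -dotpC.
Qed.

Lemma adj_SOH c : adj (\sum_i c i *: SOH_gen e i) =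
  \sum_i Num.conj (c i) *: SOH_gen e i.
Proof.
apply: adj_unique => x y; rewrite !fct_sumE dotp_suml dotp_sumr.
apply: eq_bigr => i _.
by rewrite [LHS]dotpZl [RHS]dotpZr conjCK SOH_gen_selfadjoint.
Qed.

(** The adjoints transform in the same way because [Q] is real. *)
Lemma SOH_gen_rot n (Q : 'M[R]_(n, m)) j :
  SOH_gen (rot_basis e Q) (lift ord0 j) =
  \sum_i (Q j i)%:C *: SOH_gen e (lift ord0 i).
Proof.
rewrite /SOH_gen liftK; under eq_bigr => i _ do rewrite liftK.
apply/funext => z; apply/ffunP => k.
rewrite fct_sumE hpow_sumE offdiagE.
under eq_bigr => i _ do rewrite hpowZE offdiagE.
by case: ifP => _; [rewrite /rot_basis fct_sumE|rewrite adj_rot].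
Qed.

(** In coordinates [T] is the row space of a matrix [B] that is stable under
    conjugation and contains the first unit vector [d0], the coordinates of the
    identity. The orthogonal complement of [d0] in it has a real orthonormal
    basis, whose generators together with the identity span [T] by counting
    dimensions. *)
Lemma subsystem_SOH n (T : set (hpow H 2 -> hpow H 2)) :
  operator_subsystem T (SOH e) -> has_dim T n.+1 ->
  exists2 e' : 'I_n -> H -> H, OH_basis e' & T = SOH e'.
Proof.
move=> [Te _ T1 Tadj] [b ib Tb].
have ig := SOH_gen_lin_indep he.
pose g := SOH_gen e.
have bT j : T (b j).
  rewrite Tb; exists (fun k => (k == j)%:R) => //.
  rewrite (bigD1 j)//= eqxx scale1r big1 ?addr0// => k /negPf ->.
  by rewrite scale0r.
pose B : 'M[R[i]]_(n.+1, m.+1) := \matrix_(j, k) coef g (b j) k.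
have rowB j : lin_comb g (row j B) = b j.
  rewrite -[RHS](coefP (Te _ (bT j))).
  by apply: eq_bigr => k _; rewrite !mxE.
have TB r : T (lin_comb g r) <-> (r <= B)%MS.
  split=> [|/submxP[D ->]].
    rewrite Tb => -[c _ cr]; suff -> : r = (\row_j c j) *m B by exact: submxMl.
    apply: (lin_comb_inj ig); rewrite lin_comb_mulmx -cr.
    by apply: eq_bigr => j _; rewrite mxE rowB.
  rewrite lin_comb_mulmx Tb; exists (D 0) => //.
  by apply: eq_bigr => j _; rewrite rowB.
have rB : \rank B = n.+1.
  apply/eqP/inj_row_free => D DB0; apply/rowP => j; rewrite [RHS]mxE.
  apply: ib; transitivity (lin_comb g (D *m B)).
    by rewrite lin_comb_mulmx; apply: eq_bigr => i _; rewrite rowB.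
  by rewrite DB0 /lin_comb big1// => k _; rewrite mxE scale0r.
have cB : (map_mx Num.conj B <= B)%MS.
  apply/row_subP => j; rewrite -map_row; apply/TB.
  suff -> : lin_comb g (map_mx Num.conj (row j B)) = adj (b j) by exact: Tadj.
  by rewrite -rowB adj_SOH; apply: eq_bigr => k _; rewrite mxE.
pose d0 : 'rV[R[i]]_m.+1 := delta_mx 0 0.
have d0B : (d0 <= B)%MS.
  apply/TB; suff -> : lin_comb g d0 = idfun by [].
  rewrite /lin_comb (bigD1 ord0)//= big1 => [|k /negPf k0].
    by rewrite addr0 mxE !eqxx scale1r /g /SOH_gen unlift_none.
  by rewrite mxE k0 andbF scale0r.
(* coordinates of the off-diagonal part of [T] *)
pose V := (B :&: kermx d0^T)%MS.
have rV : \rank V = n.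
  have := mxrank_mul_ker B d0^T; rewrite rB.
  have -> : \rank (B *m d0^T) = 1%N; last by case.
  apply/eqP; rewrite eqn_leq rank_leq_col /= lt0n mxrank_eq0; apply/eqP => Bd.
  have /submxP[D d0E] := d0B.
  have : d0 *m d0^T = 0 by rewrite {1}d0E -mulmxA Bd mulmx0.
  move=> /matrixP/(_ 0 0)/eqP; rewrite !mxE (bigD1 0)//= big1 => [|k /negPf k0].
    by rewrite !mxE !eqxx mulr1 addr0 oner_eq0.
  by rewrite !mxE k0 andbF mul0r.
have cV : (map_mx Num.conj V <= V)%MS.
  rewrite /V map_capmx sub_capmx (submx_trans (capmxSl _ _) cB)/=.
  apply: submx_trans (capmxSr _ _) _.
  rewrite map_kermx; suff -> : map_mx Num.conj d0^T = d0^T by [].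
  by rewrite -map_trmx map_delta_mx.
have [Q0 QQ0 QV] := real_orthonormal_rows cV rV.
have Q00 j : Q0 j 0 = 0.
  have /sub_kermxP/matrixP/(_ j 0) :
      (map_mx (real_complex R) Q0 <= kermx d0^T)%MS.
    exact: submx_trans QV (capmxSr _ _).
  rewrite !mxE (bigD1 0)//= big1 => [|k /negPf k0]; last first.
    by rewrite !mxE k0 andbF mulr0.
  by rewrite !mxE !eqxx mulr1 addr0 => /complexI.
pose Q : 'M[R]_(n, m) := \matrix_(j, i) Q0 j (lift ord0 i).
have QQ : Q *m Q^T = 1%:M.
  rewrite -QQ0; apply/matrixP => i j; rewrite !mxE big_ord_recl.
  by rewrite Q00 mul0r add0r; apply: eq_bigr => k _; rewrite !mxE.
have he' := OH_basis_rot he QQ; exists (rot_basis e Q) => //.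
pose g' := SOH_gen (rot_basis e Q).
(* coordinates of the generators of the rotated basis *)
pose M : 'M[R[i]]_(n.+1, m.+1) :=
  \matrix_(j, k) if unlift ord0 j is Some j' then (Q0 j' k)%:C else d0 0 k.
have rowM j : lin_comb g (row j M) = g' j.
  case: (unliftP ord0 j) => [j'|] ->; rewrite /lin_comb; last first.
    rewrite (bigD1 ord0)//= big1 => [|k /negPf k0].
      by rewrite addr0 !mxE unlift_none ?mxE !eqxx scale1r /g /g' /SOH_gen
        !unlift_none.
    by rewrite !mxE unlift_none ?mxE k0 andbF scale0r.
  rewrite big_ord_recl !mxE liftK Q00 scale0r add0r /g' SOH_gen_rot.
  by apply: eq_bigr => i _; rewrite !mxE liftK.
have rM : \rank M = n.+1.
  apply/eqP/inj_row_free => D DM0; apply/rowP => j; rewrite [RHS]mxE.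
  apply: (SOH_gen_lin_indep he'); transitivity (lin_comb g (D *m M)).
    by rewrite lin_comb_mulmx; apply: eq_bigr => i _; rewrite rowM.
  by rewrite DM0 /lin_comb big1// => k _; rewrite mxE scale0r.
have MB : (M <= B)%MS.
  apply/row_subP => j; case: (unliftP ord0 j) => [j'|] ->.
    have -> : row (lift ord0 j') M = row j' (map_mx (real_complex R) Q0).
      by apply/rowP => k; rewrite !mxE liftK.
    by apply: submx_trans (row_sub _ _) _; apply: submx_trans QV (capmxSl _ _).
  suff -> : row ord0 M = d0 by [].
  by apply/rowP => k; rewrite !mxE unlift_none ?mxE.
have BM : (B <= M)%MS by rewrite -(mxrank_leqif_sup MB) rM rB.
apply/seteqP; split=> x.
  move=> Tx; have [c _ cx] := Te _ Tx.
  have xE : x = lin_comb g (\row_k c k).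
    by rewrite -cx; apply: eq_bigr => k _; rewrite mxE.
  move: Tx; rewrite xE => /TB/submx_trans/(_ BM)/submxP[D ->].
  by rewrite lin_comb_mulmx; exists (D 0) => //; apply: eq_bigr => j _;
    rewrite rowM.
move=> [c _ <-]; suff -> : \sum_i c i *: SOH_gen (rot_basis e Q) i
    = lin_comb g ((\row_j c j) *m M).
  by apply/TB; apply: submx_trans (submxMl _ _) MB.
by rewrite lin_comb_mulmx; apply: eq_bigr => j _; rewrite mxE rowM.
Qed.

End Subsystem.

Theorem corollary4p3 (R : realType) (m n : nat)
  (H K : hilbertType R) (e : 'I_m -> H -> H) (f : 'I_n -> K -> K)
  (he : OH_basis e) (hf : OH_basis f)
  (T : set (hpow H 2 -> hpow H 2))
  (hT : operator_subsystem T (SOH e)) (dimT : has_dim T n.+1) :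
  unitally_coi T (SOH f).
Proof.
by have [e' he' ->] := subsystem_SOH he hT dimT; exact: SOH_coi.
Qed.
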